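(* Let $A\subset\mathbb Z$ be a finite set with $|A|\ge 6$ such that no proper arithmetic progression $a\mathbb Z+b\subsetneq\mathbb Z$ contains $|A|-1$ of the elements of $A$. Then there are only finitely many points $(p_1:p_2:p_3)\in(\mathbb C^* )^3/\mathbb C^*$ with $p_1,p_2,p_3$ pairwise distinct such that the $3\times|A|$ matrix $(p_i^a)_{i=1,2,3;\ a\in A}$ is degenerate (has rank less than 3). For every such point, the $6\times |A|$ matrix whose column indexed by $a\in A$ is $(p_1^a,\,p_2^a,\,p_3^a,\,ap_1^a,\,ap_2^a,\,ap_3^a)$ has rank at least $4$.
   Context: $\mathbb C^*=\mathbb C\setminus\{0\}$ acts on $(\mathbb C^* )^3$ by simultaneous multiplication of all three coordinates; the ranks of the matrices do not depend on the representative $(p_1,p_2,p_3)$. *)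

(* Defs.v *)
From HB Require Import structures.
From mathcomp Require Import all_boot all_order all_algebra.
From mathcomp Require Import finmap complex.
From mathcomp Require Import boolp classical_sets cardinality reals.

Set Implicit Arguments.
Unset Strict Implicit.
Unset Printing Implicit Defensive.
Import GRing.Theory Num.Theory.
Local Open Scope classical_set_scope.
Local Open Scope ring_scope.

Definition arith_prog (d b : int) : set int := [set d * k + b | k in setT].

Section Matrices.
Context {F : fieldType}.

(* The points of F*^3 / F* are the sets [torus_orbit p] with [p] in
   [torus3]. *)
Definition torus3 : set 'rV[F]_3 := [set p | forall i, p 0 i != 0].

Definition torus_orbit (p : 'rV[F]_3) : set 'rV[F]_3 :=
  [set l *: p | l in [set l : F | l != 0]].

(* The columns are indexed by the positions in the duplicate-free enumeration
   of [A]; the order of this enumeration does not affect the rank. *)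
Definition power_mx (A : {fset int}) (p : 'rV[F]_3) : 'M[F]_(3, #|` A|) :=
  \matrix_(i, j) (p 0 i ^ (enum_fset A)`_j).

Definition weighted_power_mx (A : {fset int}) (p : 'rV[F]_3) :
    'M[F]_(3, #|` A|) :=
  \matrix_(i, j) (((enum_fset A)`_j)%:~R * p 0 i ^ (enum_fset A)`_j).

Definition tangent_mx (A : {fset int}) (p : 'rV[F]_3) :
    'M[F]_(3 + 3, #|` A|) :=
  col_mx (power_mx A p) (weighted_power_mx A p).

Definition degenerate_pts (A : {fset int}) : set 'rV[F]_3 :=
  [set p | [/\ torus3 p, injective (p 0) & (\rank (power_mx A p) < 3)%N]].

End Matrices.

(* Main.v *)
(* Put x = p1/p3, y = p2/p3, t = x/y.  Degeneracy says that the points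
   (x^a, y^a) are collinear, so with q_n(z) = 1 + z + ... + z^(n-1) one has
   q_i(y) q_j(x) = q_j(y) q_i(x) for i, j in A - min A, and the same relations
   for t with exponents in max A - A.  They make y and t integral over the
   local ring of the x-line at x = 0.  Modulo x they read
   y^n q_k(y) = 0 for differences k of elements of A other than min A; since
   these differences generate Z, a power of y, and likewise of t, is divisible
   by x.  But 1 = t^i + y^k modulo x for suitable i, k > 0, so 1 is x times an
   integral element: this is an equation D(x) = 0 with D(0) <> 0, valid at all
   degenerate points at once.  For fixed x, only finitely many y remain.

   If the tangent matrix has rank < 4, each ratio l = p_i/p_j satisfies
   (u + v a) l^a = u' + v' a on A.  Squared absolute values give an identity
   e^(s a) P(a) = Q(a) between real quadratics with six zeros, so by Rolle
   s = 0 and P = Q.  Hence l^a = k (a - conj z)/(a - z) with z not real, and the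
   three ratios multiplying to 1 contradict a comparison of cubics. *)
Require Import Defs.
From HB Require Import structures.
From mathcomp Require Import all_boot all_order all_algebra.
From mathcomp Require Import finmap complex polyorder.
From mathcomp Require Import boolp classical_sets cardinality reals.
From mathcomp Require Import functions topology normedtype sequences derive realfun exp.
From mathcomp Require Import zify ring lra.

Set Implicit Arguments.
Unset Strict Implicit.
Unset Printing Implicit Defensive.
Import Order.TTheory GRing.Theory Num.Theory.
Import numFieldNormedType.Exports.
Local Open Scope classical_set_scope.
Local Open Scope ring_scope.

Definition almost_primitive (A : {fset int}) : Prop :=
  forall d b : int, arith_prog d b `<` setT ->
  ~ exists B : {fset int}, [/\ (B `<=` A)%fset,
      #|` B| = (#|` A| - 1)%N & [set` B] `<=` arith_prog d b].

(** * Almost primitive sets of exponents *)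

Section AlmostPrimitive.
Variable A : {fset int}.
Hypothesis primA : almost_primitive A.

(** By Bezout the gcd [d] of the differences [b - b0] lies in the subgroup [S], and [A] without [a]
    lies in [d Z + b0]. This progression cannot be proper, so [d] divides 1. *)
Lemma almost_primitive_ind (a b0 : int) (S : int -> Prop) :
    a \in A -> b0 \in A -> b0 != a ->
    (forall k l, S k -> S l -> S (k - l)) ->
    (forall b, b \in A -> b != a -> S (b - b0)) -> S 1.
Proof.
move=> aA b0A b0a SB SA; have S0 : S 0 by rewrite -(subrr (b0 - b0)); apply: SB; apply: SA.
have SN k : S k -> S (- k) by move=> Sk; rewrite -sub0r; apply: SB.
have SD k l : S k -> S l -> S (k + l).
  by move=> Sk Sl; rewrite -[l]opprK; apply: SB => //; exact: SN.
have SMn k n : S k -> S (k *+ n).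
  by move=> Sk; elim: n => [|n IH]; rewrite ?mulr0n // mulrS; apply: SD.
have SM k l : S k -> S (l * k).
  by move=> Sk; rewrite -[l]intz mulrzl; case: l => n; [|apply: SN]; exact: SMn.
pose gcds := foldr gcdz 0.
have Sgcd s : (forall k, k \in s -> S k) -> S (gcds s).
  elim: s => [|k s IH] // Ss /=.
  have [u [v <-]] := Bezoutz k (gcds s).
  apply: SD; apply: SM; first by apply: Ss; rewrite inE eqxx.
  by apply: IH => l ls; apply: Ss; rewrite inE ls orbT.
have dvd_gcds s k : k \in s -> (gcds s %| k)%Z.
  elim: s => [|l s IH] //=; rewrite inE => /orP[/eqP->|/IH]; first exact: dvdz_gcdl.
  by apply: dvdz_trans; exact: dvdz_gcdr.
pose d := gcds [seq b - b0 | b <- enum_fset (A `\ a)%fset].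
have Sd : S d.
  by apply: Sgcd => _ /mapP[b + ->]; rewrite in_fsetD1 => /andP[ba bA]; apply: SA.
have [apT|napT] := pselect (arith_prog d b0 = setT).
  have : arith_prog d b0 (b0 + 1) by rewrite apT.
  by case=> k _ /eqP; rewrite addrC (inj_eq (addrI _)) => /eqP <-; rewrite mulrC; apply: SM.
case: (primA (d := d) (b := b0)); first by rewrite properEneq; split => //; exact/eqP.
exists (A `\ a)%fset; split; first exact: fsubD1set.
  by rewrite [in RHS](cardfsD1 a) aA add1n subn1.
move=> b; rewrite /= in_fsetD1 => /andP[ba bA].
have : (d %| b - b0)%Z by apply/dvd_gcds/map_f; rewrite in_fsetD1 ba.
by case/dvdzP => k kE; exists k => //; rewrite mulrC -kE subrK.
Qed.

(** The exponents [k] with [z ^ k = 1] form a subgroup containing the differences of elements of [A]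
    other than [a]. *)
Lemma almost_primitive_root (F : fieldType) (a : int) (z c : F) :
    (2 <= #|` A|)%N -> a \in A -> z != 0 ->
    (forall b, b \in A -> b != a -> z ^ b = c) -> z = 1.
Proof.
move=> cardA aA z0 zc.
have [b0] : exists b0, b0 \in (A `\ a)%fset.
  by apply/fset0Pn; rewrite -cardfs_gt0; move: cardA; rewrite (cardfsD1 a) aA.
rewrite in_fsetD1 => /andP[b0a b0A].
rewrite -[LHS]expr1z.
apply: (@almost_primitive_ind a b0 (fun k => z ^ k = 1)) => // [k l zk zl|b bA ba].
  by rewrite expfzDr // -invr_expz zk zl invr1 mulr1.
by rewrite expfzDr // -invr_expz !zc // divff // -(zc b0) // expfz_neq0.
Qed.

End AlmostPrimitive.

(** * Integrality over the local ring at the origin *)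

(** Replacing [z ^+ n - 1] by its quotient by [z - 1] removes the trivial solution [z = 1] from the
    relations below. *)
Definition geom_sum {K : pzRingType} (n : nat) (z : K) : K := \sum_(i < n) z ^+ i.

Section LocallyIntegral.
Variables (F : fieldType) (K : comNzRingType) (phi : {rmorphism {poly F} -> K}).

(* Integral over the local ring of [{poly F}] at [0], with denominators cleared. *)
Definition loc_integral (v : K) : Prop :=
  exists2 s : {poly F}, s.[0] != 0 & integralOver phi (phi s * v).

(** Plays the part of the ideal generated by [x = phi 'X] among the locally integral elements;
    congruences modulo [x] are meant in this sense. *)
Definition loc_small (v : K) : Prop :=
  exists2 w, loc_integral w & v = phi 'X * w.

Lemma loc_integral_poly p : loc_integral (phi p).
Proof. by exists 1; rewrite ?hornerC ?oner_eq0 // -rmorphM; exact: integral_id. Qed.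

Lemma loc_integral1 : loc_integral 1.
Proof. by rewrite -(rmorph1 phi); exact: loc_integral_poly. Qed.

Lemma loc_integral0 : loc_integral 0.
Proof. by rewrite -(rmorph0 phi); exact: loc_integral_poly. Qed.

Lemma loc_integralM u v : loc_integral u -> loc_integral v -> loc_integral (u * v).
Proof.
move=> [s s0 su] [r r0 rv]; exists (s * r); first by rewrite hornerM mulf_neq0.
by rewrite rmorphM mulrACA; exact: integral_mul.
Qed.

Lemma loc_integralD u v : loc_integral u -> loc_integral v -> loc_integral (u + v).
Proof.
move=> [s s0 su] [r r0 rv]; exists (s * r); first by rewrite hornerM mulf_neq0.
rewrite rmorphM mulrDr -mulrA mulrCA -[X in _ + X]mulrA.
by apply: integral_add; apply: integral_mul => //; exact: integral_id.
Qed.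

Lemma loc_integralN u : loc_integral u -> loc_integral (- u).
Proof. by rewrite -mulN1r -(rmorph1 phi) -rmorphN; apply/loc_integralM/loc_integral_poly. Qed.

Lemma loc_integralB u v : loc_integral u -> loc_integral v -> loc_integral (u - v).
Proof. by move=> ? ?; apply: loc_integralD => //; exact: loc_integralN. Qed.

Lemma loc_integralX u n : loc_integral u -> loc_integral (u ^+ n).
Proof.
move=> uI; elim: n => [|n IH]; first exact: loc_integral1.
by rewrite exprS; exact: loc_integralM.
Qed.

Lemma loc_integral_geom n u : loc_integral u -> loc_integral (geom_sum n u).
Proof.
move=> uI; apply: (big_ind loc_integral) => [||i _]; first exact: loc_integral0.
  exact: loc_integralD.
exact: loc_integralX.
Qed.

(** Multiplication by [phi s ^+ n] makes the equation monic in [phi s * v]. *)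
Lemma loc_integral_root (s : {poly F}) (c : nat -> {poly F}) n v :
    s.[0] != 0 ->
    phi s * v ^+ n.+1 + \sum_(i < n.+1) phi (c i) * v ^+ i = 0 ->
  loc_integral v.
Proof.
move=> s0 eq0; exists s => //.
pose q := \poly_(i < n.+1) (c i * s ^+ (n - i)).
exists ('X^(n.+1) + q).
  rewrite monicE lead_coefDl ?lead_coefXn // size_polyXn ltnS.
  exact: size_poly.
apply/rootP; rewrite rmorphD /= map_polyXn hornerD hornerXn.
have -> : (map_poly phi q).[phi s * v] =
    phi s ^+ n * \sum_(i < n.+1) phi (c i) * v ^+ i.
  rewrite (@horner_coef_wide _ n.+1); last first.
    exact: leq_trans (size_poly _ _) (size_poly _ _).
  rewrite mulr_sumr; apply: eq_bigr => i _.
  rewrite coef_map coef_poly ltn_ord /= rmorphM rmorphXn exprMn.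
  have -> : phi s ^+ n = phi s ^+ (n - i) * phi s ^+ i by rewrite -exprD subnK // -ltnS.
  ring.
by rewrite exprMn exprSr -mulrA -mulrDr eq0 mulr0.
Qed.

Lemma loc_smallM u v : loc_integral u -> loc_small v -> loc_small (u * v).
Proof.
by move=> uI [w wI ->]; exists (u * w); [exact: loc_integralM|rewrite mulrCA].
Qed.

Lemma loc_smallD u v : loc_small u -> loc_small v -> loc_small (u + v).
Proof.
by move=> [w wI ->] [w' wI' ->]; exists (w + w'); [exact: loc_integralD|rewrite mulrDr].
Qed.

Lemma loc_smallN u : loc_small u -> loc_small (- u).
Proof. by move=> [w wI ->]; exists (- w); [exact: loc_integralN|rewrite mulrN]. Qed.

Lemma loc_smallB u v : loc_small u -> loc_small v -> loc_small (u - v).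
Proof. by move=> ? ?; apply: loc_smallD => //; exact: loc_smallN. Qed.

(* If [1 = X w] with [w] integral, multiplying the equation of [w] by a power
   of [X] turns it into an equation on [X] alone. *)
Lemma loc_small1 : loc_small 1 -> exists2 D : {poly F}, D.[0] != 0 & phi D = 0.
Proof.
move=> [w [s s0 [p p_monic /rootP pw0]] w1].
pose n := (size p).-1.
have sz : size p = n.+1 by rewrite /n prednK // size_poly_gt0 monic_neq0.
(* At 0 only the leading term [i = n] survives, with value the nonzero [s.[0] ^+ n]. *)
exists (\sum_(i < n.+1) p`_i * s ^+ i * 'X ^+ (n - i)).
  rewrite big_ord_recr /= subnn expr0 mulr1 hornerD horner_sum big1 ?add0r => [|i _].
    by move: p_monic; rewrite monicE lead_coefE -/n => /eqP ->; rewrite mul1r horner_exp expf_neq0.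
  by rewrite hornerM hornerXn -subnSK // expr0n mulr0.
have xw i : phi 'X ^+ i * w ^+ i = 1 by rewrite -exprMn -w1 expr1n.
have -> : phi (\sum_(i < n.+1) p`_i * s ^+ i * 'X ^+ (n - i)) =
    phi 'X ^+ n * (map_poly phi p).[phi s * w]; last by rewrite pw0 mulr0.
rewrite (@horner_coef_wide _ n.+1); last by rewrite -sz; exact: size_poly.
rewrite mulr_sumr rmorph_sum; apply: eq_bigr => i _ /=; rewrite coef_map.
rewrite !rmorphM !rmorphXn /= exprMn.
have -> : phi 'X ^+ n = phi 'X ^+ (n - i) * phi 'X ^+ i by rewrite -exprD subnK // -ltnS.
rewrite -[LHS]mulr1 -(xw i); ring.
Qed.

End LocallyIntegral.
Lemma fset_two_others (A : {fset int}) (a : int) : a \in A -> (3 <= #|` A|)%N ->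
  exists b b', [/\ b \in A, b' \in A, b != a, b' != a & b != b'].
Proof.
move=> aA cardA.
have [b] : exists b, b \in (A `\ a)%fset.
  by apply/fset0Pn; rewrite -cardfs_gt0; move: cardA; rewrite (cardfsD1 a) aA; lia.
rewrite in_fsetD1 => /andP[ba bA].
have [b'] : exists b', b' \in (A `\ a `\ b)%fset.
  apply/fset0Pn; rewrite -cardfs_gt0; move: cardA.
  by rewrite (cardfsD1 a) aA (cardfsD1 b) in_fsetD1 ba bA; lia.
rewrite !in_fsetD1 => /and3P[b'b b'a b'A].
by exists b, b'; split=> //; rewrite eq_sym.
Qed.

(** * Identities between geometric sums *)

Section GeometricSums.
Variable K : pzRingType.

Lemma geom_sumD m n (z : K) : geom_sum (m + n) z = geom_sum m z + z ^+ m * geom_sum n z.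
Proof.
rewrite /geom_sum big_split_ord /=; congr (_ + _).
by rewrite mulr_sumr; apply: eq_bigr => i _; rewrite exprD.
Qed.

Lemma geom_sum1 (z : K) : geom_sum 1 z = 1.
Proof. by rewrite /geom_sum big_ord1 expr0. Qed.

Lemma geom_sumS n (z : K) : geom_sum n.+1 z = 1 + z * geom_sum n z.
Proof. by rewrite -add1n geom_sumD geom_sum1 expr1. Qed.

End GeometricSums.

Lemma rmorph_geom_sum (K L : pzRingType) (f : {rmorphism K -> L}) n z :
  f (geom_sum n z) = geom_sum n (f z).
Proof. by rewrite rmorph_sum; apply: eq_bigr => i _; rewrite rmorphXn. Qed.

(** * Integrality and nilpotence modulo [x] from relations between geometric sums *)

Section GeometricRelations.
Variables (F : fieldType) (K : comNzRingType) (phi : {rmorphism {poly F} -> K}).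
Local Notation x := (phi 'X).
Local Notation loc_integral := (loc_integral phi).
Local Notation loc_small := (loc_small phi).

(** As an equation in [y] this has degree [j - 1] and, up to sign, leading coefficient
    [geom_sum i x], which is 1 at [x = 0]. *)
Lemma loc_integral_geom_eq (y : K) i j : (0 < i < j)%N ->
  geom_sum i y * geom_sum j x = geom_sum j y * geom_sum i x -> loc_integral y.
Proof.
case: i => [//|i]; case: j => [//|[//|j]] /=; rewrite !ltnS => lt_ij eq_ij.
pose s : {poly F} := geom_sum i.+1 'X.
pose c k := s - (if (k < i.+1)%N then geom_sum j.+2 'X else 0).
apply: (@loc_integral_root _ _ _ s c j).
  by rewrite /s geom_sumS hornerD hornerC hornerM hornerX mul0r addr0 oner_neq0.
have -> : \sum_(k < j.+1) phi (c k) * y ^+ k =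
   phi s * geom_sum j.+1 y - geom_sum j.+2 x * geom_sum i.+1 y.
  rewrite /c; under eq_bigr do rewrite rmorphB mulrBl.
  rewrite sumrB -mulr_sumr; congr (_ - _).
  rewrite [in RHS]/geom_sum [in RHS](big_ord_widen j.+1 (fun k => y ^+ k)) ?mulr_sumr //.
  rewrite [in RHS]big_mkcond; apply: eq_bigr => k _.
  by case: ifP; rewrite ?rmorph_geom_sum // rmorph0 mul0r.
rewrite addrA -mulrDr [X in _ * X]addrC.
have -> : geom_sum j.+1 y + y ^+ j.+1 = geom_sum j.+2 y by rewrite /geom_sum [RHS]big_ord_recr.
by rewrite /s rmorph_geom_sum mulrC -eq_ij mulrC subrr.
Qed.

(** Modulo [x] both sums in [x] are 1, so the two sums in [y] agree; their difference is
    [y ^+ i * geom_sum k y]. *)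
Lemma loc_small_geom_eq (y : K) i k : (0 < i)%N -> loc_integral y ->
  geom_sum i y * geom_sum (i + k) x = geom_sum (i + k) y * geom_sum i x ->
  loc_small (y ^+ i * geom_sum k y).
Proof.
case: i => // i _ yI eq_ik.
have xI : loc_integral x by exact: loc_integral_poly.
pose w := geom_sum i.+1 y * geom_sum (i + k) x - geom_sum (i.+1 + k) y * geom_sum i x.
exists w; first by apply: loc_integralB; apply: loc_integralM; apply: loc_integral_geom.
have -> : y ^+ i.+1 * geom_sum k y = geom_sum (i.+1 + k) y - geom_sum i.+1 y.
  by rewrite geom_sumD; ring.
move: eq_ik; rewrite (geom_sumS i x) (addSn i k) (geom_sumS (i + k) x) -(addSn i k) /w.
set g := geom_sum i.+1 y; set h := geom_sum (i.+1 + k) y => eq_ik.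
apply/eqP; rewrite -subr_eq0 -[X in _ == X](subrr (h * (1 + x * geom_sum i x))) -{2}eq_ik.
by apply/eqP; ring.
Qed.

Variables (A : {fset int}) (a : int) (y : K).
Hypotheses (primA : almost_primitive A) (aA : a \in A) (cardA : (3 <= #|` A|)%N).
Hypothesis extremal_a : (forall b, b \in A -> a <= b) \/ (forall b, b \in A -> b <= a).
Hypothesis geom_eq : forall b b', b \in A -> b' \in A -> b != a -> b' != a ->
  geom_sum `|b - a|%N y * geom_sum `|b' - a|%N x =
  geom_sum `|b' - a|%N y * geom_sum `|b - a|%N x.

(** Distances add up when measured from an end of [A]. Both ends are allowed: the minimum will serve
    [y], the maximum [t = x / y]. *)
Lemma extremal_inj b b' : b \in A -> b' \in A ->
  (`|b - a| <= `|b' - a|)%N -> (`|b' - a| = `|b - a| + `|b' - b|)%N.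
Proof. by move=> bA b'A; case: extremal_a => ext; move: (ext _ bA) (ext _ b'A); lia. Qed.

Lemma loc_integral_geom_rel : loc_integral y.
Proof.
have [b [b' [bA b'A ba b'a bb']]] := fset_two_others aA cardA.
wlog le_bb' : b b' bA b'A ba b'a bb' / (`|b - a| <= `|b' - a|)%N.
  move=> H; have [|/ltnW] := leqP `|b - a|%N `|b' - a|%N; first exact: H.
  by apply: H => //; rewrite eq_sym.
apply: (loc_integral_geom_eq _ (geom_eq bA b'A ba b'a)).
by have := extremal_inj bA b'A le_bb'; lia.
Qed.

(** The integers [k] for which [y ^+ n * geom_sum |k| y] is small form a subgroup, by [geom_sumD].
    It contains the differences [b - b0], hence 1, where the sum equals 1. *)
Lemma loc_small_geom_rel : exists2 n, (0 < n)%N & loc_small (y ^+ n).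
Proof.
have yI := loc_integral_geom_rel.
have [b0] : exists b, b \in (A `\ a)%fset.
  by apply/fset0Pn; rewrite -cardfs_gt0; move: cardA; rewrite (cardfsD1 a) aA; lia.
rewrite in_fsetD1 => /andP[b0a b0A].
pose n := `|b0 - a|%N; exists n; first by rewrite /n; lia.
have n_gt0 : (0 < n)%N by rewrite /n; lia.
pose S k := loc_small (y ^+ n * geom_sum k y).
suff : S `|1%R : int|%N by rewrite /S geom_sum1 mulr1.
apply: (almost_primitive_ind (S := fun k => S `|k|%N) primA aA b0A b0a) => [k l Sk Sl|b bA ba].
  have Sadd u v : S u -> S v -> S (u + v)%N.
    rewrite /S geom_sumD mulrDr mulrCA => Su Sv.
    by apply: loc_smallD => //; apply: loc_smallM => //; exact: loc_integralX.
  have Ssub u v : (v <= u)%N -> S u -> S v -> S (u - v)%N.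
    move=> le_vu; rewrite /S => Su Sv.
    have -> : geom_sum (u - v) y = geom_sum u y - y ^+ (u - v) * geom_sum v y.
      by rewrite -[in geom_sum u](subnK le_vu) geom_sumD addrK.
    rewrite mulrBr mulrCA; apply: loc_smallB => //.
    by apply: loc_smallM => //; exact: loc_integralX.
  have [->|[[-> ?]|[-> ?]]] : `|k - l|%N = (`|k| + `|l|)%N \/
      (`|k - l|%N = (`|k| - `|l|)%N /\ (`|l| <= `|k|)%N) \/
      (`|k - l|%N = (`|l| - `|k|)%N /\ (`|k| <= `|l|)%N) by lia.
  - exact: Sadd.
  - exact: Ssub.
  - exact: Ssub.
have [le_b0|/ltnW le_b] := leqP `|b0 - a|%N `|b - a|%N.
  apply: (loc_small_geom_eq n_gt0 yI); rewrite -(extremal_inj b0A bA le_b0).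
  exact: geom_eq.
(* For [b] nearer to [a] than [b0], the exponent [n] exceeds the one in the relation, and the spare
   power of [y] is integral. *)
rewrite /S /n (extremal_inj bA b0A le_b) addnC exprD (distnC b b0) -mulrA.
apply: loc_smallM; first exact: loc_integralX.
apply: loc_small_geom_eq => //; first by lia.
by rewrite -(extremal_inj bA b0A le_b); exact: geom_eq.
Qed.

End GeometricRelations.

(** * Incompatibility of the relations at [x = 0] *)

Section NoBranch.
Variables (F : fieldType) (K : comNzRingType) (phi : {rmorphism {poly F} -> K}).
Local Notation x := (phi 'X).
Local Notation loc_integral := (loc_integral phi).
Local Notation loc_small := (loc_small phi).

(** Powers of [u] and [1 - u] generate the unit ideal; the double induction rests on
    [w = u * w + (1 - u) * w]. *)
Lemma loc_small_coprime m n (u w : K) : loc_integral u ->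
  loc_small (u ^+ m * w) -> loc_small ((1 - u) ^+ n * w) -> loc_small w.
Proof.
move=> uI; elim: m n w => [|m IHm] n w; first by rewrite mul1r.
elim: n w => [|n IHn] w; first by rewrite mul1r.
move=> um un.
have [uI' uw] : loc_integral (1 - u) /\ loc_small (u * w).
  have uI' : loc_integral (1 - u) by apply: loc_integralB => //; exact: loc_integral1.
  split=> //; apply: (IHm n.+1); first by rewrite mulrA -exprSr.
  by rewrite mulrCA; exact: loc_smallM.
have -> : w = u * w + (1 - u) * w by ring.
apply: loc_smallD => //; apply: IHn; last by rewrite mulrA -exprSr.
by rewrite mulrCA; exact: loc_smallM.
Qed.

Lemma loc_small_expB n (u v : K) : loc_integral u -> loc_integral v ->
  loc_small (u - v) -> loc_small (v ^+ n) -> loc_small (u ^+ n).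
Proof.
move=> uI vI uv vn; rewrite -[u ^+ n](subrK (v ^+ n)); apply: loc_smallD => //.
rewrite subrXX mulrC; apply: loc_smallM => //.
apply: (big_ind loc_integral) => [||i _]; first exact: loc_integral0.
  exact: loc_integralD.
by apply: loc_integralM; exact: loc_integralX.
Qed.

(** Since [i] and [k] are positive, the equation reads [1 - t ^+ i = y ^+ k] modulo [x]. Hence
    [t ^+ i] and [1 - t ^+ i] are both nilpotent modulo [x]. *)
Lemma loc_small1_branch (y t : K) i k m n : (0 < i)%N -> (0 < k)%N ->
  loc_integral y -> loc_integral t -> loc_small (y ^+ n) -> loc_small (t ^+ m) ->
  x ^+ (i + k) - y ^+ k * x ^+ i - 1 - t ^+ i * x ^+ k + y ^+ k + t ^+ i = 0 ->
  loc_small 1.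
Proof.
case: i => // i; case: k => // k _ _ yI tI yn tm eq0.
have xI : loc_integral x by exact: loc_integral_poly.
have XI z j : loc_integral z -> loc_integral (z ^+ j) by exact: loc_integralX.
have small : loc_small ((1 - t ^+ i.+1) - y ^+ k.+1).
  exists (x ^+ (i + k.+1) - y ^+ k.+1 * x ^+ i - t ^+ i.+1 * x ^+ k).
    by do ![apply: loc_integralB]; do ?[apply: loc_integralM]; exact: XI.
  apply/eqP; rewrite -subr_eq0 -oppr_eq0 -[X in _ == X]eq0; apply/eqP.
  by rewrite addSn !(exprS x); ring.
apply: (@loc_small_coprime m n (t ^+ i.+1)); rewrite ?mulr1; first exact: XI.
  by rewrite exprAC exprS mulrC; apply: loc_smallM => //; apply/XI/XI.
apply: loc_small_expB small _; last 1 first.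
- by rewrite exprAC exprS mulrC; apply: loc_smallM => //; apply/XI/XI.
- by apply: loc_integralB; [exact: loc_integral1|exact: XI].
- exact: XI.
Qed.

End NoBranch.
(** * Finiteness of the degenerate points *)

Lemma fset_min (A : {fset int}) : A != fset0 -> exists2 a, a \in A & forall b, b \in A -> a <= b.
Proof.
case/fset0Pn => a0 a0A.
case: (@Order.TotalTheory.arg_minP _ _ A [` a0A]%fset xpredT val isT) => a _ amin.
by exists (val a) => [|b bA]; [exact: valP | exact: (amin [` bA]%fset isT)].
Qed.

Lemma fset_max (A : {fset int}) : A != fset0 -> exists2 a, a \in A & forall b, b \in A -> b <= a.
Proof.
case/fset0Pn => a0 a0A.
case: (@Order.TotalTheory.arg_maxP _ _ A [` a0A]%fset xpredT val isT) => a _ amax.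
by exists (val a) => [|b bA]; [exact: valP | exact: (amax [` bA]%fset isT)].
Qed.

Lemma rank_lt_kernel (F : fieldType) m n (M : 'M[F]_(m, n)) :
  (\rank M < m)%N -> exists2 u : 'rV_m, u != 0 & u *m M = 0.
Proof.
move=> rkM; have : kermx M != 0 by rewrite kermx_eq0 /row_free neq_ltn rkM.
by case/rowV0Pn => u uM u0; exists u => //; apply/sub_kermxP.
Qed.

(** The nonzero vector with entries [C * (x - 1)] and [C' * (y - 1)] is killed by a 2 by 2 matrix of
    geometric sums, so its determinant vanishes. *)
Lemma geom_sum_cross (F : fieldType) (x y C C' : F) e e' :
    x != 1 -> y != 1 -> ~~ ((C == 0) && (C' == 0)) ->
    C * (x ^+ e - 1) + C' * (y ^+ e - 1) = 0 ->
    C * (x ^+ e' - 1) + C' * (y ^+ e' - 1) = 0 ->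
  geom_sum e y * geom_sum e' x = geom_sum e' y * geom_sum e x.
Proof.
rewrite -[x == 1]subr_eq0 -[y == 1]subr_eq0 !subrX1 -!/(geom_sum _ _) => x1 y1 C0 eq1 eq2.
have [u1 u2] : C * (x - 1) * (geom_sum e y * geom_sum e' x - geom_sum e' y * geom_sum e x) = 0 /\
   C' * (y - 1) * (geom_sum e y * geom_sum e' x - geom_sum e' y * geom_sum e x) = 0.
  move: eq1 eq2; set g := geom_sum e y; set h := geom_sum e' y.
  set g' := geom_sum e x; set h' := geom_sum e' x => eq1 eq2; split.
    apply: etrans (_ : g * (C * ((x - 1) * h') + C' * ((y - 1) * h)) -
      h * (C * ((x - 1) * g') + C' * ((y - 1) * g)) = _).
      by ring.
    by rewrite eq1 eq2 !mulr0 subrr.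
  apply: etrans (_ : h' * (C * ((x - 1) * g') + C' * ((y - 1) * g)) -
    g' * (C * ((x - 1) * h') + C' * ((y - 1) * h)) = _).
    by ring.
  by rewrite eq1 eq2 !mulr0 subrr.
apply/eqP; rewrite -subr_eq0; move: C0; apply: contraNT => g0.
move/eqP: u1; move/eqP: u2; rewrite !mulf_eq0 (negPf g0) (negPf x1) (negPf y1) !orbF.
by move=> -> ->.
Qed.

(** * Degenerate points in the affine chart where the third coordinate is 1 *)

Section CollinearPowers.
Variable F : fieldType.

Definition collinear_powers (A : {fset int}) (x y : F) : Prop :=
  [/\ x != 0, y != 0, [/\ x != 1, y != 1 & x != y] &
    exists c : F * F * F, [/\ c != 0 &
      forall a, a \in A -> c.1.1 * x ^ a + c.1.2 * y ^ a + c.2 = 0]].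

Lemma degenerate_collinear A p : degenerate_pts (F := F) A p ->
  collinear_powers A (p 0 0 / p 0 ord_max) (p 0 1 / p 0 ord_max).
Proof.
move=> [p0 injp rkp].
have neq i j : i != j -> p 0 i / p 0 j != 1.
  move=> ij; apply: contra ij => /eqP e; apply/eqP/injp.
  by rewrite -[LHS](divfK (p0 j)) e mul1r.
split; rewrite ?mulf_neq0 ?invr_neq0 //; try exact: p0.
  split; try exact: neq.
  by rewrite (inj_eq (mulIf (invr_neq0 (p0 _)))) (inj_eq injp).
have [u u0 uM] := rank_lt_kernel rkp.
exists (u 0 0, u 0 1, u 0 ord_max); split.
  apply: contra u0 => /eqP [u1 u2 u3]; apply/eqP/rowP => i; rewrite mxE.
  case: i => [[|[|[|//]]]] lti; [rewrite -[RHS]u1|rewrite -[RHS]u2|rewrite -[RHS]u3];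
    by congr (u _ _); apply/val_inj.
move=> a aA; have lta : (index a (enum_fset A) < #|` A|)%N by rewrite index_mem.
have /(congr1 (fun v : 'rV_ _ => v 0 (Ordinal lta))) := uM.
rewrite !mxE !big_ord_recl big_ord0 !mxE /= nth_index // addr0 addrA.
have -> : lift ord0 ord0 = 1 :> 'I_3 by apply/val_inj.
have -> : lift ord0 (lift ord0 ord0) = ord_max :> 'I_3 by apply/val_inj.
move=> e; rewrite !expfzMl; apply/eqP.
rewrite -(inj_eq (mulIf (expfz_neq0 a (p0 ord_max)))) mul0r -[X in _ == X]e; apply/eqP.
have inv : (p 0 ord_max)^-1 ^ a * p 0 ord_max ^ a = 1.
  by rewrite -expfzMl mulVf ?exp1rz //; exact: p0.
by rewrite !mulrDl -!mulrA !inv !mulr1.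
Qed.

Variables (A : {fset int}) (x y : F).
Hypothesis coll : collinear_powers A x y.

(** Subtracting the equation at [a0] eliminates [c.2]. If the other two coefficients vanished, the
    equation at [a0] would give [c.2 = 0] too. *)
Lemma collinear_powers_min a0 : a0 \in A -> (forall b, b \in A -> a0 <= b) ->
  exists C C', ~~ ((C == 0) && (C' == 0)) /\
    forall b, b \in A -> C * (x ^+ `|b - a0|%N - 1) + C' * (y ^+ `|b - a0|%N - 1) = 0.
Proof.
case: coll => x0 y0 _ [c [c0 ceq]] a0A mina.
exists (c.1.1 * x ^ a0), (c.1.2 * y ^ a0); split.
  apply: contra c0; rewrite !mulf_eq0 !(negPf (expfz_neq0 _ _)) // !orbF => /andP[/eqP c1 /eqP c2].
  have := ceq _ a0A; rewrite c1 c2 !mul0r !add0r => c3.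
  by apply/eqP; move: c1 c2 c3; case: (c) => -[c1 c2] c3 /= -> -> ->.
move=> b bA; have eb : b = a0 + `|b - a0|%N :> int by have := mina _ bA; lia.
have := ceq _ bA; rewrite [in x ^ _]eb [in y ^ _]eb !expfzDr // => eqb.
rewrite -[RHS](subrr (0 : F)) -{1}eqb -(ceq _ a0A) -!exprnP; ring.
Qed.

(** With [n = a0 - b], subtracting the equation at [a0] from [x ^+ n] times that at [b] eliminates
    [c.1.1]; factoring out [y ^ a0] leaves powers of [x / y]. *)
Lemma collinear_powers_max a0 : a0 \in A -> (forall b, b \in A -> b <= a0) ->
  exists C C', ~~ ((C == 0) && (C' == 0)) /\
    forall b, b \in A -> C * (x ^+ `|b - a0|%N - 1) + C' * ((x / y) ^+ `|b - a0|%N - 1) = 0.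
Proof.
case: coll => x0 y0 _ [c [c0 ceq]] a0A maxa.
exists c.2, (c.1.2 * y ^ a0); split.
  apply: contra c0; rewrite !mulf_eq0 !(negPf (expfz_neq0 _ _)) // !orbF => /andP[/eqP c3 /eqP c2].
  have := ceq _ a0A; rewrite c3 c2 !mul0r !addr0 => /eqP.
  rewrite mulf_eq0 (negPf (expfz_neq0 _ _)) // orbF => /eqP c1.
  by apply/eqP; move: c1 c2 c3; case: (c) => -[c1 c2] c3 /= -> -> ->.
move=> b bA; have eb : a0 = b + `|b - a0|%N :> int by have := maxa _ bA; lia.
have eqb := ceq _ bA; have := ceq _ a0A.
have -> : x ^ a0 = x ^ b * x ^+ `|b - a0|%N by rewrite {1}eb expfzDr.
have -> : y ^ a0 = y ^ b * y ^+ `|b - a0|%N by rewrite {1}eb expfzDr.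
rewrite expr_div_n; set n := `|b - a0|%N => eqa0.
rewrite -[RHS](subrr (0 : F)) -{2}eqa0 -[X in _ = X - _](mulr0 (x ^+ n)) -eqb.
have yn : y ^+ n != 0 by rewrite expf_neq0.
by field.
Qed.

Lemma collinear_powers_geom a0 : a0 \in A -> (forall b, b \in A -> a0 <= b) ->
  forall b b', b \in A -> b' \in A ->
  geom_sum `|b - a0|%N y * geom_sum `|b' - a0|%N x =
  geom_sum `|b' - a0|%N y * geom_sum `|b - a0|%N x.
Proof.
move=> a0A mina b b' bA b'A.
have [C [C' [C0 eqC]]] := collinear_powers_min a0A mina.
by case: coll => _ _ [x1 y1 _] _; apply: (geom_sum_cross x1 y1 C0); exact: eqC.
Qed.

Lemma collinear_powers_geom_div a0 : a0 \in A -> (forall b, b \in A -> b <= a0) ->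
  forall b b', b \in A -> b' \in A ->
  geom_sum `|b - a0|%N (x / y) * geom_sum `|b' - a0|%N x =
  geom_sum `|b' - a0|%N (x / y) * geom_sum `|b - a0|%N x.
Proof.
move=> a0A maxa b b' bA b'A.
have [C [C' [C0 eqC]]] := collinear_powers_max a0A maxa.
case: coll => _ y0 [x1 _ xy] _; apply: (geom_sum_cross x1 _ C0); try exact: eqC.
by apply: contra xy => /eqP e; rewrite -(divfK y0 x) e mul1r.
Qed.

(** Multiplying by [(x - 1) * (y - 1)], expanding and dividing by [y ^+ i] leaves an equation
    polynomial in [x], [y] and [x / y]. *)
Lemma geom_cross_branch i k :
    geom_sum i y * geom_sum (i + k) x = geom_sum (i + k) y * geom_sum i x ->
  x ^+ (i + k) - y ^+ k * x ^+ i - 1 - (x / y) ^+ i * x ^+ k + y ^+ k + (x / y) ^+ i = 0.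
Proof.
case: coll => _ y0 _ _ eq_g.
have : (y ^+ i - 1) * (x ^+ (i + k) - 1) = (y ^+ (i + k) - 1) * (x ^+ i - 1).
  by rewrite !subrX1 -!/(geom_sum _ _) mulrACA eq_g [(y - 1) * (x - 1)]mulrC; ring.
have yi : y ^+ i != 0 by rewrite expf_neq0.
move=> e; apply: (mulfI yi); rewrite mulr0 -[RHS](subrr ((y ^+ i - 1) * (x ^+ (i + k) - 1))) {2}e.
rewrite expr_div_n !exprD; field.
by [].
Qed.

End CollinearPowers.
Lemma infinite_set_seq (T : choiceType) (X : set T) : infinite_set X ->
  exists2 f : nat -> T, injective f & forall n, X (f n).
Proof.
elim/choicePpointed: T => T in X *.
  by rewrite (_ : X = set0) ?emptyE // => /(_ (finite_set0 _)).
move=> /infiniteP/pcard_leP[f]; exists f => [i j|n]; last exact: (@funS _ _ _ _ f n I).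
by apply: (@inj _ _ _ f); exact: in_setT.
Qed.

(** * Sequences of degenerate points and finiteness in the chart *)

Section Sequences.
Variable F : fieldType.

(* A sequence of points is handled as a single point over the ring of sequences,
   so that the equation found for its abscissa is uniform. *)
Definition eval_seq (xs : nat -> F) (p : {poly F}) : nat -> F := fun n => p.[xs n].

Lemma eval_seq_zmod_morphism xs : zmod_morphism (eval_seq xs).
Proof. by move=> p q; apply/funext => n; rewrite /eval_seq hornerD hornerN. Qed.

Lemma eval_seq_monoid_morphism xs : monoid_morphism (eval_seq xs).
Proof.
by split=> [|p q]; apply/funext => n; rewrite /eval_seq ?hornerM // hornerC.
Qed.

HB.instance Definition _ xs :=
  GRing.isZmodMorphism.Build {poly F} (nat -> F) (eval_seq xs) (eval_seq_zmod_morphism xs).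
HB.instance Definition _ xs :=
  GRing.isMonoidMorphism.Build {poly F} (nat -> F) (eval_seq xs) (eval_seq_monoid_morphism xs).

Lemma geom_sum_fctE n (f : nat -> F) k : geom_sum n f k = geom_sum n (f k).
Proof. by rewrite /geom_sum fct_sumE; apply: eq_bigr => i _; rewrite exprfctE. Qed.

Variable A : {fset int}.
Hypotheses (primA : almost_primitive A) (cardA : (3 <= #|` A|)%N).

(** The minimum of [A] makes [ys] nilpotent modulo [xs], the maximum does so for [ts], and the
    branch equation makes 1 small. *)
Lemma collinear_seq (xs ys : nat -> F) : (forall n, collinear_powers A (xs n) (ys n)) ->
  exists2 D : {poly F}, D != 0 & forall n, root D (xs n).
Proof.
move=> coll; have A0 : A != fset0 by rewrite -cardfs_gt0; lia.
have [a aA mina] := fset_min A0; have [b bA maxb] := fset_max A0.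
pose phi : {rmorphism {poly F} -> (nat -> F)} := eval_seq xs.
have phiX : phi 'X = xs by apply/funext => n; rewrite /phi /= /eval_seq hornerX.
pose ts : nat -> F := fun n => xs n / ys n.
have rely : forall b b', b \in A -> b' \in A -> b != a -> b' != a ->
   geom_sum `|b - a|%N ys * geom_sum `|b' - a|%N (phi 'X) =
   geom_sum `|b' - a|%N ys * geom_sum `|b - a|%N (phi 'X).
  move=> u v uA vA _ _; rewrite phiX; apply/funext => n; rewrite !mulrfctE !geom_sum_fctE.
  exact: (collinear_powers_geom (coll n) aA mina uA vA).
have relt : forall u v, u \in A -> v \in A -> u != b -> v != b ->
   geom_sum `|u - b|%N ts * geom_sum `|v - b|%N (phi 'X) =
   geom_sum `|v - b|%N ts * geom_sum `|u - b|%N (phi 'X).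
  move=> u v uA vA _ _; rewrite phiX; apply/funext => n; rewrite !mulrfctE !geom_sum_fctE.
  exact: (collinear_powers_geom_div (coll n) bA maxb uA vA).
have yI := loc_integral_geom_rel aA cardA (or_introl mina) rely.
have [n _ yn] := loc_small_geom_rel primA aA cardA (or_introl mina) rely.
have tI := loc_integral_geom_rel bA cardA (or_intror maxb) relt.
have [m _ tm] := loc_small_geom_rel primA bA cardA (or_intror maxb) relt.
(* The gaps [u - a] and [v - u] are the positive exponents [i] and [k] of the branch equation. *)
have [u [v [uA vA ua uv]]] : exists u v, [/\ u \in A, v \in A, a < u & u < v].
  have [u [v [uA vA ua va uv]]] := fset_two_others aA cardA.
  have := mina _ uA; have := mina _ vA; have [ltuv|ltvu] : u < v \/ v < u by lia.
    by exists u, v; split=> //; lia.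
  by exists v, u; split=> //; lia.
have [D D0 phiD] : exists2 D, D.[0] != 0 & phi D = 0.
  apply: loc_small1; apply: (loc_small1_branch (i := `|u - a|%N) (k := `|v - u|%N) _ _ yI tI yn tm).
  - by lia.
  - by lia.
  rewrite phiX; apply/funext => l.
  have := geom_cross_branch (coll l) (i := `|u - a|%N) (k := `|v - u|%N).
  have -> : (`|u - a| + `|v - u| = `|v - a|)%N by lia.
  rewrite (collinear_powers_geom (coll l) aA mina uA vA) => /(_ erefl).
  by rewrite !(addrfctE, opprfctE, mulrfctE, exprfctE).
have Dn0 : D != 0 by apply: contraNneq D0 => ->; rewrite horner0.
exists D => // l; apply/rootP; exact: (congr1 (fun f : nat -> F => f l) phiD).
Qed.

Lemma finite_roots (p : {poly F}) : p != 0 -> finite_set [set z | root p z].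
Proof.
move=> p0; apply: contrapT => /infinite_set_seq[f f_inj rootf].
suff : (size (mkseq f (size p)) < size p)%N by rewrite size_mkseq ltnn.
apply: max_poly_roots => //; first by apply/allP => _ /mapP[k _ ->]; exact: rootf.
by rewrite mkseq_uniq.
Qed.

(** Infinitely many abscissas would yield a sequence of distinct roots of one nonzero polynomial;
    over each abscissa, [y] is also a root of a nonzero polynomial. *)
Lemma finite_collinear : finite_set [set z : F * F | collinear_powers A z.1 z.2].
Proof.
pose X := [set x : F | exists y, collinear_powers A x y].
have finX : finite_set X.
  apply: contrapT => /infinite_set_seq[f f_inj /choice[ys coll]].
  have [D D0 rootD] := collinear_seq coll.
  suff : infinite_set [set z | root D z] by apply; exact: finite_roots.
  apply: (@sub_infinite_set _ (range f)) => [_ [n _ <-]|]; first exact: rootD.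
  by move/(finite_preimage (in2W f_inj)); rewrite preimage_range; exact: infinite_nat.
have A0 : A != fset0 by rewrite -cardfs_gt0; lia.
have [a aA mina] := fset_min A0.
have finY (x : F) : finite_set [set y | collinear_powers A x y].
  have [[y0 [x0 _ [x1 _ _] _]]|noy] := pselect (exists y, collinear_powers A x y); last first.
    by apply: sub_finite_set (finite_set0 _) => y coll; apply: noy; exists y.
  (* Otherwise all powers of [x] with exponent in [A] would coincide and force [x = 1]. *)
  have [b [bA ba xb]] : exists b, [/\ b \in A, b != a & x ^+ `|b - a|%N != 1].
    apply: contrapT => nob; case/eqP: x1.
    apply: (@almost_primitive_root A primA F a x (x ^ a)) => //; first by lia.
    move=> b bA ba; have [xb|xb] := eqVneq (x ^+ `|b - a|%N) 1; last by case: nob; exists b.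
    have -> : b = a + `|b - a|%N by have := mina _ bA; lia.
    by rewrite expfzDr // -exprnP xb mulr1.
  have [c [cA ca cb]] : exists c, [/\ c \in A, c != a & c != b].
    have [u [v [uA vA ua va uv]]] := fset_two_others aA cardA.
    have [ub|ub] := eqVneq u b; last by exists u.
    by exists v; rewrite -ub; split=> //; rewrite eq_sym.
  pose i := `|b - a|%N; pose j := `|c - a|%N.
  (* Its coefficient in degree [j] is [x ^+ i - 1], nonzero by the choice of [b]; its value at [y]
     is the geometric relation times [(x - 1) * (y - 1)]. *)
  pose p : {poly F} := (x ^+ i - 1) *: ('X^j - 1) - (x ^+ j - 1) *: ('X^i - 1).
  have ji : (j == i) = false by rewrite /i /j; move: (mina _ bA) (mina _ cA); lia.
  have j0 : (j == 0%N) = false by rewrite /j; lia.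
  have p0 : p != 0.
    apply: contraNneq xb => /(congr1 (fun q : {poly F} => q`_j)).
    rewrite coef0 coefB !coefZ !coefB !coefXn coef1 eqxx ji j0 /= !subr0 mulr0 subr0 mulr1.
    by move/eqP; rewrite subr_eq0.
  apply: sub_finite_set (finite_roots p0) => y coll; apply/rootP.
  have := collinear_powers_geom coll aA mina bA cA; rewrite -/i -/j => eq_g.
  rewrite !hornerE !subrX1 -!/(geom_sum _ _).
  by rewrite mulrACA [geom_sum i x * _]mulrC -eq_g; ring.
apply: (@sub_finite_set _ _ (\bigcup_(x in X)
    [set (x, y) | y in [set y | collinear_powers A x y]])).
  by move=> [x y] /= coll; exists x; [exists y|exists y].
by apply: bigcup_finite => // x _; exact: finite_image.
Qed.
End Sequences.

(** * Passage from the affine chart to torus orbits *)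

Lemma torus_orbitZ (F : fieldType) (l : F) (p : 'rV[F]_3) :
  l != 0 -> torus_orbit (l *: p) = torus_orbit p.
Proof.
move=> l0; apply/seteqP; split => _ [m /= m0 <-].
  by exists (m * l); rewrite /= ?mulf_neq0 ?scalerA.
by exists (m / l); rewrite /= ?mulf_neq0 ?invr_eq0 // scalerA divfK.
Qed.

Definition affine_point (F : fieldType) (z : F * F) : 'rV[F]_3 :=
  \row_i [:: z.1; z.2; 1]`_i.

Lemma affine_point_ratio (F : fieldType) (p : 'rV[F]_3) : p 0 ord_max != 0 ->
  p = p 0 ord_max *: affine_point (p 0 0 / p 0 ord_max, p 0 1 / p 0 ord_max).
Proof.
move=> p0; apply/rowP => k; rewrite !mxE.
case: k => [[|[|[|//]]]] ltk /=; rewrite ?mulr1 1?mulrC ?divfK //;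
  by congr (p _ _); apply/val_inj.
Qed.

Lemma finite_degenerate_orbits (F : fieldType) (A : {fset int}) :
    almost_primitive A -> (3 <= #|` A|)%N ->
  finite_set [set torus_orbit p | p in degenerate_pts (F := F) A].
Proof.
move=> primA cardA.
have finA := finite_image (torus_orbit \o @affine_point F) (finite_collinear F primA cardA).
apply: sub_finite_set finA => _ [p deg_p <-].
have [p0 _ _] := deg_p.
rewrite [in X in _ X](affine_point_ratio (p0 ord_max)) torus_orbitZ; last exact: p0.
exists (p 0 0 / p 0 ord_max, p 0 1 / p 0 ord_max) => //.
exact: (degenerate_collinear deg_p).
Qed.

(** * Zeros of real exponential polynomials *)

Section ExponentialPolynomials.
Variable R : realType.
Implicit Types (f : R -> R) (p q : {poly R}).

(** Keeping the first zero as a strict lower bound of the new ones lets the induction prepend the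
    point given by Rolle. *)
Lemma rolle_zeros f f' x (s : seq R) : (forall z, is_derive z (1 : R) f (f' z)) ->
    path <%R x s -> f x = 0 -> (forall z, z \in s -> f z = 0) ->
  exists s', [/\ size s' = size s, path <%R x s' & forall z, z \in s' -> f' z = 0].
Proof.
move=> df; elim: s x => [|y s IH] x; first by exists [::].
move=> /= /andP[xy pathy] fx0 fs0.
have fy0 : f y = 0 by apply: fs0; rewrite inE eqxx.
have [s' [sz paths' f's']] : exists s',
    [/\ size s' = size s, path <%R y s' & forall z, z \in s' -> f' z = 0].
  by apply: IH => // z zs; apply: fs0; rewrite inE zs orbT.
have [|c|c] := @Rolle R f x y xy _ _ (etrans fx0 (esym fy0)).
- by move=> z _; exact: (@ex_derive _ _ _ _ _ _ _ (df z)).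
- apply: continuous_subspaceT => z; apply: differentiable_continuous.
  by apply/derivable1_diffP; exact: (@ex_derive _ _ _ _ _ _ _ (df z)).
rewrite in_itv /= => /andP[xc cy] dc.
exists (c :: s'); split.
- by rewrite /= sz.
- rewrite /= xc /=; case: s' paths' {sz f's'} => //= d s' /andP[yd ->].
  by rewrite (lt_trans cy yd).
move=> z; rewrite inE => /orP[/eqP->|]; last exact: f's'.
by rewrite -(@derive_val _ _ _ _ _ _ _ (df c)) (@derive_val _ _ _ _ _ _ _ dc).
Qed.

Lemma is_derive_exp_poly s p q z :
  is_derive z (1 : R) (fun x => expR (s * x) * p.[x] - q.[x])
    (expR (s * z) * (s *: p + p^`()).[z] - q^`().[z]).
Proof.
have ds : is_derive z (1 : R) (fun x => s * x) s.
  by rewrite -[X in is_derive _ _ _ X]mulr1; exact: (is_deriveZ s (is_derive_id z (1 : R))).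
have de : is_derive z (1 : R) (fun x => expR (s * x)) (expR (s * z) * s).
  exact: (is_derive1_comp (is_derive_expR (s * z)) ds).
have := is_deriveB (is_deriveM de (is_derive_poly p z)) (is_derive_poly q z).
by move/is_derive_eq; apply; rewrite /GRing.scale /= hornerD hornerZ; ring.
Qed.

(** Each differentiation costs one zero and lowers the bound on [q] by one, while the bound on [p]
    persists. Once [q] is gone, [p] has at least [m] roots. *)
Lemma exp_poly_zeros s p q m n (zs : seq R) : s != 0 ->
    (size p <= m)%N -> (size q <= n)%N -> (m + n <= size zs)%N -> sorted <%R zs ->
    (forall z, z \in zs -> expR (s * z) * p.[z] = q.[z]) ->
  p = 0 /\ q = 0.
Proof.
move=> s0; elim: n m p q zs => [|n IH] m p q zs szp szq szz szs eqpq.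
  have q0 : q = 0 by apply/eqP; rewrite -size_poly_leq0.
  split=> //; apply: (@roots_geq_poly_eq0 _ p zs).
  - apply/allP => z /eqpq /eqP; rewrite q0 horner0 mulf_eq0 expR_eq0 /=.
    by rewrite rootE.
  - exact: lt_sorted_uniq.
  - by rewrite (leq_trans szp) // -[m]addn0.
case: zs szz szs eqpq => [|x zs] //=; first by rewrite addnS.
rewrite addnS ltnS => szz pathx eqpq.
have [|z zzs|zs' [sz' path' eq']] := rolle_zeros (is_derive_exp_poly s p q) pathx.
- by apply/eqP; rewrite subr_eq0 eqpq // inE eqxx.
- by apply/eqP; rewrite subr_eq0 eqpq // inE zzs orbT.
have [p0 q0] : s *: p + p^`() = 0 /\ q^`() = 0.
  apply: (IH m _ _ zs') => //.
  - rewrite (leq_trans (size_polyD _ _)) // geq_max (leq_trans (size_scale_leq _ _)) //=.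
    by rewrite size_deriv (leq_trans (leq_pred _)).
  - by move: szq; rewrite size_deriv; case: size.
  - by rewrite sz'.
  - exact: path_sorted path'.
  - by move=> z /eq'/eqP; rewrite subr_eq0 => /eqP.
(* The derivative of a nonzero [p] is shorter than [s *: p], so the two cannot cancel. *)
have {}p0 : p = 0.
  apply/eqP; apply: contraT => pn0; have := lt_size_deriv pn0.
  by rewrite -(size_scale p s0) -[s *: p](addrK p^`()) p0 sub0r size_polyN ltnn.
split=> //; have szq1 : (size q <= 1)%N.
  by have := size_deriv q; rewrite q0 size_poly0; case: size => [|[]].
have := eqpq x (mem_head _ _); rewrite p0 horner0 mulr0 (size1_polyC szq1) hornerC => <-.
exact: polyC0.
Qed.

End ExponentialPolynomials.
(** * The rank of the tangent matrix *)

Section TangentRelations.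
Variable R : realType.
Local Notation C := R[i].
Local Open Scope complex_scope.

Definition sqnorm (z : C) : R := complex.Re z ^+ 2 + complex.Im z ^+ 2.

Lemma sqnormM : {morph sqnorm : z w / z * w}.
Proof. by move=> [a b] [c d]; rewrite /sqnorm /=; ring. Qed.

Lemma sqnorm1 : sqnorm 1 = 1.
Proof. by rewrite /sqnorm /=; ring. Qed.

Lemma sqnorm_eq0 z : (sqnorm z == 0) = (z == 0).
Proof.
case: z => a b; rewrite /sqnorm /= eq_complex /= paddr_eq0 ?sqr_ge0 //.
by rewrite !sqrf_eq0.
Qed.

Lemma sqnorm_gt0 z : z != 0 -> 0 < sqnorm z.
Proof. by move=> z0; rewrite lt_neqAle eq_sym sqnorm_eq0 z0 addr_ge0 ?sqr_ge0. Qed.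

Lemma sqnorm_expz z (k : int) : z != 0 -> sqnorm (z ^ k) = expR (ln (sqnorm z) * k%:~R).
Proof.
move=> z0; have sq_pos w : w != 0 -> sqnorm w \is Num.pos by rewrite posrE; exact: sqnorm_gt0.
have expn n : sqnorm (z ^+ n) = expR (ln (sqnorm z) * n%:R).
  rewrite expRM_natr lnK ?sq_pos //.
  by elim: n => [|n IH]; rewrite ?sqnorm1 // !exprS sqnormM IH.
case: k => n; first exact: expn.
rewrite NegzE -exprnN mulrNz mulrN expRN -expn.
apply: (mulIf (x := sqnorm (z ^+ n.+1))); first by rewrite sqnorm_eq0 expf_neq0.
by rewrite -sqnormM mulVf ?expf_neq0 // mulVf ?sqnorm1 // sqnorm_eq0 expf_neq0.
Qed.

Definition sqnorm_affine (u v : C) : {poly R} :=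
  ((complex.Re u)%:P + complex.Re v *: 'X) ^+ 2 + ((complex.Im u)%:P + complex.Im v *: 'X) ^+ 2.

Lemma sqnorm_affineE u v (t : R) : (sqnorm_affine u v).[t] = sqnorm (u + v * t%:C).
Proof.
by case: u v => [a b] [c d]; rewrite /sqnorm_affine /sqnorm !hornerE /=; ring.
Qed.

Lemma size_sqnorm_affine u v : (size (sqnorm_affine u v) <= 3)%N.
Proof.
have sz a b : (size ((a%:P + b *: 'X : {poly R}) ^+ 2) <= 3)%N.
  have sz2 : (size (a%:P + b *: 'X : {poly R})%R <= 2)%N.
    rewrite (leq_trans (size_polyD _ _)) // geq_max (leq_trans (size_polyC_leq1 _)) //=.
    by rewrite (leq_trans (size_scale_leq _ _)) // size_polyX.
  by rewrite expr2 (leq_trans (size_polyMleq _ _)) //; move: sz2; lia.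
by rewrite (leq_trans (size_polyD _ _)) // geq_max !sz.
Qed.

Lemma intr_complex (k : int) : k%:~R = (k%:~R : R)%:C :> C.
Proof. by rewrite rmorph_int. Qed.

Lemma sqnorm_affine_eq0 u v : sqnorm_affine u v = 0 -> u = 0 /\ v = 0.
Proof.
move=> uv0; have eq0 t : u + v * t%:C = 0.
  by apply/eqP; rewrite -sqnorm_eq0 -sqnorm_affineE uv0 horner0.
have u0 : u = 0 by have := eq0 0; rewrite mulr0 addr0.
by split=> //; have := eq0 1; rewrite u0 add0r mulr1.
Qed.

(** With [z = - u / v], the quadratic is |v|^2 (t - z)(t - conj z): it determines |v|, and [z] up to
    conjugation. *)
Lemma sqnorm_affine_inj u v u' v' : sqnorm_affine u v = sqnorm_affine u' v' -> v != 0 ->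
  exists z, [/\ v' != 0, u = - (v * z) & u' = - (v' * z) \/ u' = - (v' * conjc z)].
Proof.
move=> eq_uv v0.
have eqt t : sqnorm (u + v * t%:C) = sqnorm (u' + v' * t%:C).
  by rewrite -!sqnorm_affineE eq_uv.
have eq_v : sqnorm v = sqnorm v'.
  have := eqt 0; have := eqt 1; have := eqt (-1).
  case: (u) (v) (u') (v') => [a b] [c d] [a' b'] [c' d'].
  rewrite /sqnorm /=; lra.
have v'0 : v' != 0 by rewrite -sqnorm_eq0 -eq_v sqnorm_eq0.
pose z := - u / v; pose w := - u' / v'.
have uE : u = - (v * z) by rewrite /z; field.
have uE' : u' = - (v' * w) by rewrite /w; field.
exists z; split => //.
have eqt' (t : R) : sqnorm (t%:C - z) = sqnorm (t%:C - w).
  apply: (mulfI (x := sqnorm v)); first by rewrite sqnorm_eq0.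
  rewrite [X in _ = X * _]eq_v -!sqnormM !mulrBr.
  by have := eqt t; rewrite {1}uE {1}uE' ![- _ + _]addrC.
have [re_zw im_zw] : complex.Re z = complex.Re w /\
    (complex.Im z == complex.Im w) || (complex.Im z == - complex.Im w).
  have := eqt' 0; have := eqt' 1; have := eqt' (-1); rewrite -eqf_sqr.
  move: z w {uE uE' eqt'} => [a b] [c d]; rewrite /sqnorm /= => e1 e2 e3.
  have ac : a = c by lra.
  by split=> //; apply/eqP; move: e3; rewrite ac; lra.
move: uE'; move: re_zw im_zw; case: (z) (w) => [a b] [c d] /= ->.
case/orP => /eqP-> ->; first by left.
by right; rewrite opprK.
Qed.

End TangentRelations.

(** * Ratios whose powers on [A] are quotients of affine functions *)

Section Pairs.
Variables (R : realType) (A : {fset int}).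
Local Notation C := R[i].
Local Open Scope complex_scope.
Hypotheses (primA : almost_primitive A) (cardA : (6 <= #|` A|)%N).

Lemma int_zeros : exists zs : seq R, [/\ sorted <%R zs, size zs = #|` A| &
  forall z, z \in zs -> exists2 a, a \in A & z = a%:~R].
Proof.
exists (sort <=%R [seq a%:~R | a <- enum_fset A]); split.
- rewrite sort_lt_sorted map_inj_uniq ?fset_uniq //; exact: intr_inj.
- by rewrite size_sort size_map.
by move=> z; rewrite mem_sort => /mapP[a aA ->]; exists a.
Qed.

(** Six zeros match the two size bounds 3 of [exp_poly_zeros]: a nonzero [ln (sqnorm l)] would make
    both quadratics vanish. When it is 0, their difference has too many roots. *)
Lemma sqnorm_affine_eq (l u v u' v' : C) : l != 0 ->
    ~ [/\ u = 0, v = 0, u' = 0 & v' = 0] ->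
    (forall a, a \in A -> (u + v * a%:~R) * l ^ a = u' + v' * a%:~R) ->
  sqnorm_affine u v = sqnorm_affine u' v'.
Proof.
move=> l0 nz rel; have [zs [zs_sorted sz_zs zsA]] := int_zeros.
have rel_sq z : z \in zs ->
    expR (ln (sqnorm l) * z) * (sqnorm_affine u v).[z] = (sqnorm_affine u' v').[z].
  move=> /zsA[a aA ->]; rewrite !sqnorm_affineE -!intr_complex -(rel a aA) sqnormM.
  by rewrite sqnorm_expz // mulrC.
have [s0|s0] := eqVneq (ln (sqnorm l)) 0; last first.
  case: nz.
  have sz6 : (3 + 3 <= size zs)%N by rewrite sz_zs.
  by have [/sqnorm_affine_eq0[-> ->] /sqnorm_affine_eq0[-> ->]] :=
    exp_poly_zeros s0 (size_sqnorm_affine u v) (size_sqnorm_affine u' v') sz6 zs_sorted rel_sq.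
apply/eqP; rewrite -subr_eq0; apply/eqP.
apply: (@roots_geq_poly_eq0 _ _ zs); last 1 first.
- rewrite sz_zs (leq_trans _ cardA) // (leq_trans (size_polyD _ _)) // size_polyN.
  by rewrite geq_max !(leq_trans (size_sqnorm_affine _ _)).
- apply/allP => z /rel_sq; rewrite s0 mul0r expR0 mul1r => e.
  by rewrite rootE hornerD hornerN e subrr.
- exact: lt_sorted_uniq.
Qed.

Lemma nonreal_sub_neq0 (z : C) (a : int) : z != conjc z -> a%:~R - z != 0.
Proof.
apply: contra; rewrite subr_eq0 => /eqP <-.
by rewrite intr_complex /= oppr0.
Qed.

(** If both affine functions are constant, or have the same zero, then [l ^ a] is constant on [A] up
    to one element and [l = 1]. Only conjugate nonreal zeros remain. *)
Lemma affine_exp_rel (l u v u' v' : C) : l != 0 -> l != 1 ->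
    ~ [/\ u = 0, v = 0, u' = 0 & v' = 0] ->
    (forall a, a \in A -> (u + v * a%:~R) * l ^ a = u' + v' * a%:~R) ->
  exists z k, [/\ z != conjc z, k != 0 &
    forall a, a \in A -> l ^ a * (a%:~R - z) = k * (a%:~R - conjc z)].
Proof.
move=> l0 l1 nz rel; have card2 : (2 <= #|` A|)%N by apply: leq_trans cardA.
have [a0 a0A] : exists a0, a0 \in A by apply/fset0Pn; rewrite -cardfs_gt0 (leq_trans _ cardA).
have eq_sq := sqnorm_affine_eq l0 nz rel.
have [v0|v0] := eqVneq v 0.
  have [v'0|v'0] := eqVneq v' 0; last first.
    by have [z []] := sqnorm_affine_inj (esym eq_sq) v'0; rewrite v0 eqxx.
  have u0 : u != 0.
    apply/eqP => u0; case: nz; split => //.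
    by have := rel _ a0A; rewrite u0 v0 v'0 !mul0r !addr0 mul0r.
  case/eqP: l1; apply: (almost_primitive_root primA card2 a0A l0 (c := u' / u)) => b bA _.
  by have := rel _ bA; rewrite v0 v'0 !mul0r !addr0 => <-; field.
have [z [v'0 uE u'E]] := sqnorm_affine_inj eq_sq v0.
have relz a w : a \in A -> u' = - (v' * w) -> l ^ a * (a%:~R - z) = v' / v * (a%:~R - w).
  move=> /rel; rewrite uE => e u'w; apply: (mulfI v0).
  apply: etrans (_ : (- (v * z) + v * a%:~R) * l ^ a = _); first by ring.
  by rewrite e u'w; field.
have [u'z|u'z] := eqVneq u' (- (v' * z)).
  (* [a1] is the element of [A] equal to [z], if there is one: there [a - z] cannot be cancelled. *)
  have [a1 a1A a1z] : exists2 a1, a1 \in A & forall b, b \in A -> b != a1 -> b%:~R - z != 0.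
    have [[a1 [a1A a1z]]|noa1] := pselect (exists a1, a1 \in A /\ a1%:~R = z).
      by exists a1 => // b _; rewrite -a1z subr_eq0 eqr_int.
    by exists a0 => // b bA _; rewrite subr_eq0; apply/eqP => bz; apply: noa1; exists b.
  case/eqP: l1; apply: (almost_primitive_root primA card2 a1A l0 (c := v' / v)) => b bA ba1.
  by apply: (mulIf (a1z _ bA ba1)); exact: relz.
case: u'E => [/eqP|u'E]; first by rewrite (negPf u'z).
exists z, (v' / v); split=> [||a aA]; last exact: relz.
  by apply: contraNneq u'z => zz; rewrite u'E -zz.
by rewrite mulf_neq0 ?invr_eq0.
Qed.

(** Multiplying the first two relations and comparing with the third gives two cubics that agree on
    [A], hence everywhere. Matching their roots forces [z = w = v], and then [z] is real. *)
Lemma affine_exp_rel_triple (l l' z w v k k' k'' : C) :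
    l != 0 -> l' != 0 -> l * l' != 1 ->
    z != conjc z -> w != conjc w -> v != conjc v ->
    k != 0 -> k' != 0 -> k'' != 0 ->
    (forall a, a \in A -> l ^ a * (a%:~R - z) = k * (a%:~R - conjc z)) ->
    (forall a, a \in A -> l' ^ a * (a%:~R - w) = k' * (a%:~R - conjc w)) ->
    (forall a, a \in A -> (l * l') ^ a * (a%:~R - v) = k'' * (a%:~R - conjc v)) ->
  False.
Proof.
move=> l0 l'0 ll' zz ww vv k0 k'0 k''0 relz relw relv.
have [a0 a0A] : exists a0, a0 \in A by apply/fset0Pn; rewrite -cardfs_gt0 (leq_trans _ cardA).
have card2 : (2 <= #|` A|)%N by apply: leq_trans cardA.
have cubic a : a \in A ->
    (k * k') * ((a%:~R - conjc z) * (a%:~R - conjc w) * (a%:~R - v)) =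
    k'' * ((a%:~R - z) * (a%:~R - w) * (a%:~R - conjc v)).
  move=> aA.
  apply: etrans (_ : (k * (a%:~R - conjc z)) * (k' * (a%:~R - conjc w)) * (a%:~R - v) = _).
    by ring.
  rewrite -relz // -relw //.
  apply: etrans (_ : ((l ^ a * l' ^ a) * (a%:~R - v)) * ((a%:~R - z) * (a%:~R - w)) = _).
    by ring.
  by rewrite -expfzMl relv //; ring.
pose cub (x y t : C) : {poly C} := \prod_(c <- [:: x; y; t]) ('X - c%:P).
have sz_cub x y t : size (cub x y t) = 4%N by rewrite /cub size_prod_XsubC.
have cubE x y t s : (cub x y t).[s] = (s - x) * (s - y) * (s - t).
  by rewrite horner_prod !big_cons big_nil !hornerE /=; ring.
pose P := (k * k') *: cub (conjc z) (conjc w) v - k'' *: cub z w (conjc v).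
have PE s : P.[s] = (k * k') * ((s - conjc z) * (s - conjc w) * (s - v)) -
    k'' * ((s - z) * (s - w) * (s - conjc v)).
  by rewrite hornerD hornerN !hornerZ !cubE.
have P0 : P = 0.
  apply: (@roots_geq_poly_eq0 _ _ [seq a%:~R | a <- enum_fset A]).
  - by apply/allP => _ /mapP[a aA ->]; rewrite rootE PE cubic // subrr.
  - by rewrite map_inj_uniq ?fset_uniq //; exact: intr_inj.
  rewrite size_map (leq_trans _ cardA) // (leq_trans (size_polyD _ _)) // size_polyN.
  by rewrite geq_max !(leq_trans (size_scale_leq _ _)) // sz_cub.
have cub_eq s : (k * k') * ((s - conjc z) * (s - conjc w) * (s - v)) =
    k'' * ((s - z) * (s - w) * (s - conjc v)).
  by apply/eqP; rewrite -subr_eq0 -PE P0 horner0.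
(* If [w] were conjugate to [z], all factors would cancel and [(l * l') ^ a] would be constant. *)
have w_ne_conj : w != conjc z.
  apply/eqP => wz; case/eqP: ll'.
  have ll0 : l * l' != 0 by rewrite mulf_neq0.
  apply: (almost_primitive_root primA card2 a0A ll0 (c := k * k')) => a aA _.
  apply: (mulIf (mulf_neq0 (nonreal_sub_neq0 a zz) (nonreal_sub_neq0 a ww))).
  rewrite expfzMl mulrACA relz // relw // wz conjcK; ring.
(* The left cubic vanishes at [conjc z], and among the roots on the right only [conjc v] can equal
   it. *)
have vz : v = z.
  have /esym/eqP := cub_eq (conjc z); rewrite subrr !mul0r mulr0.
  rewrite !mulf_eq0 (negPf k''0) !subr_eq0 /= eq_sym (negPf zz) /= eq_sym (negPf w_ne_conj) /=.
  by move=> /eqP e; rewrite -[LHS]conjcK -e conjcK.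
have wz : w = z.
  have /esym/eqP := cub_eq (conjc w); rewrite subrr mulr0 mul0r mulr0.
  rewrite !mulf_eq0 (negPf k''0) !subr_eq0 /= [_ == w]eq_sym (negPf ww) /= orbF vz.
  case/orP => /eqP e; first by case/eqP: w_ne_conj; rewrite -e conjcK.
  by rewrite -[LHS]conjcK e conjcK.
have [b [c [bA cA _ _ bc]]] := fset_two_others a0A (leq_trans (isT : 3 <= 6)%N cardA).
have lin a : a \in A -> k * k' * (a%:~R - conjc z) = k'' * (a%:~R - z).
  move=> aA; have zbar : conjc z != conjc (conjc z) by rewrite conjcK eq_sym.
  apply: (mulIf (mulf_neq0 (nonreal_sub_neq0 a zz) (nonreal_sub_neq0 a zbar))).
  by have := cubic _ aA; rewrite vz wz => e; apply: etrans (etrans e _); ring.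
have kk : k * k' = k''.
  have bc0 : b%:~R - c%:~R != 0 :> C by rewrite subr_eq0 eqr_int.
  apply: (mulIf bc0); apply: etrans (_ : k'' * (b%:~R - z) - k'' * (c%:~R - z) = _); last by ring.
  by rewrite -!lin //; ring.
case/eqP: zz; have := lin _ bA; rewrite kk => /(mulfI k''0)/addrI/oppr_inj.
by [].
Qed.

End Pairs.
(** Rank below 4 makes the four rows of index [i] or [j] in the two blocks dependent. The signs come
    from moving the [j] terms to the right. *)
Lemma tangent_relation (F : fieldType) (A : {fset int}) (p : 'rV[F]_3) i j :
    (\rank (tangent_mx A p) < 4)%N ->
  exists u v u' v', ~ [/\ u = 0, v = 0, u' = 0 & v' = 0] /\
    forall a, a \in A -> (u + v * a%:~R) * p 0 i ^ a = (u' + v' * a%:~R) * p 0 j ^ a.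
Proof.
move=> rk; pose P := power_mx A p; pose W := weighted_power_mx A p.
pose N := col_mx (col_mx (row i P) (row i W)) (col_mx (row j P) (row j W)).
have sub_tan : (N <= tangent_mx A p)%MS.
  have PT : (P <= tangent_mx A p)%MS by rewrite -addsmxE addsmxSl.
  have WT : (W <= tangent_mx A p)%MS by rewrite -addsmxE addsmxSr.
  by rewrite !col_mx_sub !(submx_trans (row_sub _ _)).
have [u u0 uN] := rank_lt_kernel (leq_ltn_trans (mxrankS sub_tan) rk).
pose ul := lsubmx u; pose ur := rsubmx u.
exists (lsubmx ul 0 0), (rsubmx ul 0 0), (- lsubmx ur 0 0), (- rsubmx ur 0 0).
split.
  case=> e1 e2 /eqP; rewrite oppr_eq0 => /eqP e3 /eqP; rewrite oppr_eq0 => /eqP e4.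
  case/eqP: u0; rewrite -[u]hsubmxK -[lsubmx u]hsubmxK -[rsubmx u]hsubmxK.
  have z (m : 'rV[F]_1) : m 0 0 = 0 -> m = 0 by move=> m0; apply/rowP => k; rewrite ord1 m0 mxE.
  by rewrite (z _ e1) (z _ e2) (z _ e3) (z _ e4) !row_mx0.
move=> a aA; have lta : (index a (enum_fset A) < #|` A|)%N by rewrite index_mem.
move: uN; rewrite -[u]hsubmxK -[lsubmx u]hsubmxK -[rsubmx u]hsubmxK /N !mul_row_col.
move/(congr1 (fun v : 'rV_ _ => v 0 (Ordinal lta))).
rewrite !mxE !big_ord1 !mxE /= nth_index // -/ul -/ur => e.
apply/eqP; rewrite -subr_eq0; apply/eqP; apply: etrans e; ring.
Qed.

(** The ratios of coordinates 0 to 1 and 1 to 2 multiply to that of 0 to 2; injectivity keeps all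
    three different from 1. *)
Lemma tangent_rank (R : realType) (A : {fset int}) (p : 'rV[R[i]]_3) :
    almost_primitive A -> (6 <= #|` A|)%N -> torus3 p -> injective (p 0) ->
  (4 <= \rank (tangent_mx A p))%N.
Proof.
move=> primA cardA p0 injp; rewrite leqNgt; apply/negP => rk.
have pair i j : i != j -> exists z k, [/\ z != conjc z, k != 0 &
    forall a, a \in A -> (p 0 i / p 0 j) ^ a * (a%:~R - z) = k * (a%:~R - conjc z)].
  move=> ij; have [u [v [u' [v' [nz rel]]]]] := tangent_relation i j rk.
  apply: (affine_exp_rel primA cardA _ _ nz).
  - by rewrite mulf_neq0 ?invr_eq0 //; exact: p0.
  - apply: contra ij => /eqP e; apply/eqP/injp.
    by rewrite -[LHS](divfK (p0 j)) e mul1r.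
  move=> a aA; apply: (mulIf (expfz_neq0 a (p0 j))).
  rewrite -(rel a aA) expfzMl -!mulrA -expfzMl mulVf ?exp1rz ?mulr1 //; exact: p0.
have [z [k [zz k0 relz]]] := pair 0 1 isT.
have [w [k' [ww k'0 relw]]] := pair 1 ord_max isT.
have [v [k'' [vv k''0 relv]]] := pair 0 ord_max isT.
have mulE : (p 0 0 / p 0 1) * (p 0 1 / p 0 ord_max) = p 0 0 / p 0 ord_max.
  by rewrite mulrA divfK //; exact: p0.
apply: (affine_exp_rel_triple primA cardA _ _ _ zz ww vv k0 k'0 k''0 relz relw).
- by rewrite mulf_neq0 ?invr_eq0 //; exact: p0.
- by rewrite mulf_neq0 ?invr_eq0 //; exact: p0.
- rewrite mulE; apply/eqP => e; suff : (0 : 'I_3) = ord_max by [].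
  by apply: injp; rewrite -[LHS](divfK (p0 ord_max)) e mul1r.
by rewrite mulE.
Qed.

Theorem theorem1p5 (R : realType) (A : {fset int})
  (hA : (6 <= #|` A|)%N)
  (hAP : forall d b : int, arith_prog d b `<` setT ->
     ~ exists B : {fset int}, [/\ (B `<=` A)%fset,
         #|` B| = (#|` A| - 1)%N & [set` B] `<=` arith_prog d b]) :
  finite_set [set torus_orbit p | p in degenerate_pts (F := R[i]) A] /\
  (forall p : 'rV[R[i]]_3, degenerate_pts A p ->
     (4 <= \rank (tangent_mx A p))%N).
Proof.
split; first by apply: finite_degenerate_orbits => //; exact: leq_trans hA.
by move=> p [p0 injp _]; exact: tangent_rank.
Qed.
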